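(* Let $A$ be a coherent quantale. The following are equivalent: (1) the quantale $A$ has LP; (2) the frame $R(A)$ has LP; (3) the lattice $L(A)$ has Id-BLP; (4) the quantale $A$ is B-normal; (5) the frame $R(A)$ is B-normal; (6) the lattice $L(A)$ is B-normal.
   Context: A quantale is a complete lattice $(A,\vee,\wedge,0,1)$ with an associative, commutative multiplication $\cdot$ with unit $1$ distributing over arbitrary joins; a frame is a quantale whose multiplication is $\wedge$. $K(A)$ is the set of compact elements; $A$ is coherent if every element is a join of compact elements, $1\in K(A)$ and $K(A)$ is closed under $\cdot$. $B(A)$ is the Boolean algebra of complemented elements. An element $p<1$ is m-prime if $a\cdot b\le p$ implies $a\le p$ or $b\le p$; $\rho(a)=\bigwedge\{p \text{ m-prime}: a\le p\}$. $R(A)=\{a\in A:\rho(a)=a\}$ is a frame with meets $\bigwedge$ and joins $\dot\bigvee_i a_i=\rho(\bigvee_i a_i)$. The reticulation $L(A)$ is the quotient $K(A)/\!\equiv$, where $c\equiv d$ iff $\rho(c)=\rho(d)$, a bounded distributive lattice with $[c]\vee[d]=[c\vee d]$, $[c]\wedge[d]=[c\cdot d]$, bottom $[0]$, top $[1]$. For a quantale $Q$ and $a\in Q$, $[a)_Q=\{x\in Q:a\le x\}$ is a quantale with the lattice operations of $Q$, bottom $a$, top $1$, multiplication $x\cdot_a y=(x\cdot y)\vee a$. An element $a$ of $Q$ has LP if the Boolean morphism $B(Q)\to B([a)_Q)$, $e\mapsto e\vee a$, is surjective; $Q$ has LP if every element has LP (this applies to the frame $R(A)$, with joins $\dot\vee$).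 $Q$ is B-normal if for all $a,b\in Q$ with $a\vee b=1$ there exist $e,f\in B(Q)$ with $a\vee e=b\vee f=1$ and $e\cdot f=0$ (for the frame $R(A)$, $\cdot$ is $\wedge$, $\vee$ is $\dot\vee$ and $0$ is $\rho(0)$). A bounded distributive lattice $L$ is B-normal if for all $a,b\in L$ with $a\vee b=1$ there exist complemented $e,f\in L$ with $a\vee e=b\vee f=1$ and $e\wedge f=0$. $L$ has Id-BLP if for every ideal $I$ of $L$, the Boolean morphism $B(L)\to B(L/I)$ induced by the canonical projection $L\to L/I$ is surjective, where $B(\cdot)$ denotes the complemented elements and $L/I$ is the quotient of $L$ by the congruence $x\sim y$ iff $x\vee i=y\vee i$ for some $i\in I$. *)

(* Defs.v *)
From HB Require Import structures.
From mathcomp Require Import all_boot all_order.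
From mathcomp Require Import boolp classical_sets functions cardinality.

Set Implicit Arguments.
Unset Strict Implicit.
Unset Printing Implicit Defensive.

Import Order.LTheory.
Local Open Scope classical_set_scope.
Local Open Scope order_scope.
Local Open Scope quotient_scope.

(* The unit of the multiplication is the top element of the lattice. *)
HB.mixin Record TBLattice_isQuantale (d : Order.disp_t) (T : Type)
    of Order.TBLattice d T := {
  qsup : set T -> T;
  qmul : T -> T -> T;
  qsup_isLub : forall S : set T, isLub S (qsup S);
  qmulA : associative qmul;
  qmulC : commutative qmul;
  qmul1x : left_id (\top : T) qmul;
  qmul_qsup : forall (x : T) (S : set T),
    qmul x (qsup S) = qsup [set qmul x y | y in S]
}.

#[short(type="quantaleType")]
HB.structure Definition Quantale (d : Order.disp_t) :=
  { T of Order.TBLattice d T & TBLattice_isQuantale d T }.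

Notation "x *q y" := (qmul x y) (at level 40, left associativity) : order_scope.

Definition is_frame (d : Order.disp_t) (Q : quantaleType d) : Prop :=
  forall x y : Q, x *q y = x `&` y.

Definition qinf (d : Order.disp_t) (Q : quantaleType d) (S : set Q) : Q :=
  qsup (lbound S).

Definition compact_elt (d : Order.disp_t) (Q : quantaleType d) (c : Q) : Prop :=
  forall S : set Q, c <= qsup S ->
    exists F : set Q, [/\ finite_set F, (F `<=` S)%classic & c <= qsup F].

HB.mixin Record Quantale_isCoherent (d : Order.disp_t) (T : Type)
    of Quantale d T := {
  compact_gen : forall a : T, exists S : set T,
    (forall c, S c -> compact_elt c) /\ a = qsup S;
  compact_top : compact_elt (\top : T);
  compact_qmul : forall c e : T,
    compact_elt c -> compact_elt e -> compact_elt (c *q e)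
}.

#[short(type="coherentQuantaleType")]
HB.structure Definition CoherentQuantale (d : Order.disp_t) :=
  { T of Quantale d T & Quantale_isCoherent d T }.

Definition mprime (d : Order.disp_t) (Q : quantaleType d) (p : Q) : Prop :=
  p < \top /\ forall a b : Q, a *q b <= p -> a <= p \/ b <= p.

Definition rho (d : Order.disp_t) (Q : quantaleType d) (a : Q) : Q :=
  qinf [set p | mprime p /\ a <= p].

Definition complemented (d : Order.disp_t) (L : tbLatticeType d) : set L :=
  [set e | exists f : L, e `&` f = \bot /\ e `|` f = \top].
Arguments complemented {d} L.

Section QuantaleTheory.
Context (d : Order.disp_t) (Q : quantaleType d).
Implicit Types (x y z a b : Q) (S : set Q).

Lemma qsup_ub S x : S x -> x <= qsup S.
Proof. by move=> Sx; case: (qsup_isLub S) => + _; apply. Qed.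

Lemma qsup_le S y : (forall x, S x -> x <= y) -> qsup S <= y.
Proof. by move=> Sy; case: (qsup_isLub S) => _; apply. Qed.

Lemma qinf_lb S x : S x -> qinf S <= x.
Proof. by move=> Sx; apply: qsup_le => y; apply. Qed.

Lemma le_qinf S y : (forall x, S x -> y <= x) -> y <= qinf S.
Proof. by move=> Sy; apply: qsup_ub. Qed.

Lemma qsup2 x y : qsup [set x; y]%classic = x `|` y.
Proof.
apply/le_anti/andP; split.
  by apply: qsup_le => z [->|->]; [exact: leUl|exact: leUr].
by rewrite leUx !qsup_ub//=; [right|left].
Qed.

Lemma qmulx1 x : x *q \top = x.
Proof. by rewrite qmulC qmul1x. Qed.

Lemma qmulUr x y z : x *q (y `|` z) = (x *q y) `|` (x *q z).
Proof. by rewrite -!qsup2 qmul_qsup image_setU !image_set1. Qed.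

Lemma qmulUl x y z : (y `|` z) *q x = (y *q x) `|` (z *q x).
Proof. by rewrite qmulC qmulUr ![x *q _]qmulC. Qed.

Lemma le_qmul2l x y z : y <= z -> x *q y <= x *q z.
Proof. by move=> /join_idPl yz; rewrite -yz qmulUr leUr. Qed.

Lemma le_qmul x y a b : x <= a -> y <= b -> x *q y <= a *q b.
Proof.
move=> xa yb; apply: (le_trans (le_qmul2l x yb)).
by rewrite ![_ *q b]qmulC le_qmul2l.
Qed.

Lemma qmul_lel x y : x *q y <= x.
Proof. by rewrite -{2}(qmulx1 x) le_qmul2l// lex1. Qed.

Lemma qmul_ler x y : x *q y <= y.
Proof. by rewrite qmulC qmul_lel. Qed.

Lemma qmul_leI x y : x *q y <= x `&` y.
Proof. by rewrite lexI qmul_lel qmul_ler. Qed.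

Lemma rho_ge x : x <= rho x.
Proof. by apply: le_qinf => p []. Qed.

Lemma rho_le_mprime x p : mprime p -> x <= p -> rho x <= p.
Proof. by move=> pp xp; apply: qinf_lb. Qed.

Lemma le_rho x y : x <= y -> rho x <= rho y.
Proof.
by move=> xy; apply: le_qinf => p [pp yp]; apply: rho_le_mprime => //; exact: le_trans yp.
Qed.

Lemma rhoK x : rho (rho x) = rho x.
Proof.
apply/le_anti; rewrite rho_ge andbT.
by apply: le_qinf => p [pp xp]; do 2!apply: rho_le_mprime => //.
Qed.

Lemma rho_le x y : (rho x <= rho y) = (x <= rho y).
Proof.
apply/idP/idP => [|xy]; first exact/le_trans/rho_ge.
by rewrite -(rhoK y) le_rho.
Qed.

Lemma rho1 : rho (\top : Q) = \top.
Proof. by apply/le_anti; rewrite lex1 rho_ge. Qed.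

Lemma rhoM x y : rho (x *q y) = rho x `&` rho y.
Proof.
apply/le_anti/andP; split.
  by rewrite lexI !le_rho ?qmul_lel ?qmul_ler.
apply: le_qinf => p [pp /(pp.2 _ _)[xp|yp]].
  by apply: (le_trans (leIl _ _)); exact: rho_le_mprime.
by apply: (le_trans (leIr _ _)); exact: rho_le_mprime.
Qed.

Lemma rhoI x y : rho (x `&` y) = rho x `&` rho y.
Proof.
apply/le_anti/andP; split; first by rewrite lexI !le_rho ?leIl ?leIr.
by rewrite -rhoM le_rho ?qmul_leI.
Qed.

Lemma rhoU x y : rho (rho x `|` rho y) = rho (x `|` y).
Proof.
apply/le_anti/andP; split; last by rewrite le_rho// leU2 ?rho_ge.
by rewrite rho_le leUx !le_rho ?leUl ?leUr.
Qed.

Lemma rhoUI x y z :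
  rho (x `|` y) `&` rho z = rho (rho (x *q z) `|` rho (y *q z)).
Proof. by rewrite rhoU -qmulUl rhoM. Qed.

Lemma compact_bot : compact_elt (\bot : Q).
Proof. by move=> S _; exists set0; split=> //; rewrite le0x. Qed.

Lemma compactU x y : compact_elt x -> compact_elt y -> compact_elt (x `|` y).
Proof.
move=> cx cy S; rewrite leUx => /andP[/cx[F [finF FS xF]] /cy[G [finG GS yG]]].
exists (F `|` G)%classic; split; first by rewrite finite_setU.
  by move=> z [/FS|/GS].
rewrite leUx; apply/andP; split.
  by apply: (le_trans xF); apply: qsup_le => z Fz; apply: qsup_ub; left.
by apply: (le_trans yG); apply: qsup_le => z Gz; apply: qsup_ub; right.
Qed.

End QuantaleTheory.

Section UpSet.
Context (d : Order.disp_t) (Q : quantaleType d) (a : Q).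

Record upset := Upset { upset_val : Q; upset_ge : a <= upset_val }.

HB.instance Definition _ := [isSub for upset_val].
HB.instance Definition _ := [Choice of upset by <:].
HB.instance Definition _ := [SubChoice_isSubPOrder of upset by <: with d].

Definition to_upset (x : Q) : upset := Upset (leUr a x).

Implicit Types x y z : upset.

Fact upset_meet_subproof x y : a <= upset_val x `&` upset_val y.
Proof. by rewrite lexI !upset_ge. Qed.

Fact upset_join_subproof x y : a <= upset_val x `|` upset_val y.
Proof. by rewrite lexU2 ?upset_ge. Qed.

Definition upset_meet x y : upset := Upset (upset_meet_subproof x y).
Definition upset_join x y : upset := Upset (upset_join_subproof x y).

Fact upset_meetP x y z : (x <= upset_meet y z) = (x <= y) && (x <= z).
Proof. by rewrite -!Order.le_val lexI. Qed.

Fact upset_joinP x y z : (upset_join x y <= z) = (x <= z) && (y <= z).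
Proof. by rewrite -!Order.le_val leUx. Qed.

HB.instance Definition _ :=
  Order.POrder_MeetJoin_isLattice.Build d upset upset_meetP upset_joinP.

Definition upset_bot : upset := Upset (lexx a).
Definition upset_top : upset := Upset (lex1 a).

Fact upset_le0x x : upset_bot <= x.
Proof. by rewrite -Order.le_val upset_ge. Qed.

Fact upset_lex1 x : x <= upset_top.
Proof. by rewrite -Order.le_val lex1. Qed.

HB.instance Definition _ := Order.hasBottom.Build d upset upset_le0x.
HB.instance Definition _ := Order.hasTop.Build d upset upset_lex1.

(* The join with [a] only matters for the empty join. *)
Definition upset_qsup (S : set upset) : upset :=
  to_upset (qsup [set upset_val x | x in S]).

Definition upset_qmul x y : upset := to_upset (upset_val x *q upset_val y).

Fact upset_qsup_isLub (S : set upset) : isLub S (upset_qsup S).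
Proof.
split=> [x Sx|b Sb]; rewrite -Order.le_val /=.
  by rewrite lexU2// qsup_ub//; exists x.
rewrite leUx upset_ge andbT; apply: qsup_le => _ [x Sx <-].
by rewrite (Order.le_val x b) Sb.
Qed.

Fact upset_qmulA : associative upset_qmul.
Proof.
move=> x y z; apply/val_inj => /=; rewrite qmulUr qmulUl qmulA.
rewrite -!joinA; congr (_ `|` _).
by rewrite (join_idPr (qmul_ler _ _)) (join_idPr (qmul_lel _ _)).
Qed.

Fact upset_qmulC : commutative upset_qmul.
Proof. by move=> x y; apply/val_inj => /=; rewrite qmulC. Qed.

Fact upset_qmul1x : left_id (\top : upset) upset_qmul.
Proof.
move=> x; apply/val_inj => /=; rewrite qmul1x.
exact/join_idPl/upset_ge.
Qed.

Fact upset_qmul_qsup x (S : set upset) :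
  upset_qmul x (upset_qsup S) = upset_qsup [set upset_qmul x y | y in S].
Proof.
apply/val_inj => /=; rewrite qmulUr qmul_qsup -joinA (join_idPr (qmul_ler _ _)).
apply/le_anti; rewrite !leUx !leUr !andbT; apply/andP; split.
  apply: qsup_le => _ [_ [y Sy <-] <-];
  apply: lexU2; apply/orP; left; apply: (le_trans (leUl _ a)); apply: qsup_ub.
  by exists (upset_qmul x y) => //; exists y.
apply: qsup_le => _ [_ [y Sy <-] <-] /=; rewrite leUx leUr andbT.
apply: lexU2; apply/orP; left; apply: qsup_ub.
by exists (upset_val y) => //; exists y.
Qed.

HB.instance Definition _ := TBLattice_isQuantale.Build d upset
  upset_qsup_isLub upset_qmulA upset_qmulC upset_qmul1x upset_qmul_qsup.

End UpSet.

Section Radical.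
Context (d : Order.disp_t) (Q : quantaleType d).

Record radical := Radical { radical_val : Q; radicalP : rho radical_val == radical_val }.

HB.instance Definition _ := [isSub for radical_val].
HB.instance Definition _ := [Choice of radical by <:].
HB.instance Definition _ := [SubChoice_isSubPOrder of radical by <: with d].

Implicit Types x y z : radical.

Lemma radical_rho x : rho (radical_val x) = radical_val x.
Proof. exact/eqP/radicalP. Qed.

Fact to_radical_subproof (x : Q) : rho (rho x) == rho x.
Proof. by rewrite rhoK. Qed.

Definition to_radical (x : Q) : radical := Radical (to_radical_subproof x).

Lemma to_radical_le (x : Q) y : (to_radical x <= y) = (x <= radical_val y).
Proof. by rewrite -Order.le_val /= -{1}(radical_rho y) rho_le radical_rho. Qed.

Fact radical_meet_subproof x y :
  rho (radical_val x `&` radical_val y) == radical_val x `&` radical_val y.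
Proof. by rewrite rhoI !radical_rho. Qed.

Definition radical_meet x y : radical := Radical (radical_meet_subproof x y).
Definition radical_join x y : radical :=
  to_radical (radical_val x `|` radical_val y).

Fact radical_meetP x y z : (x <= radical_meet y z) = (x <= y) && (x <= z).
Proof. by rewrite -!Order.le_val lexI. Qed.

Fact radical_joinP x y z : (radical_join x y <= z) = (x <= z) && (y <= z).
Proof. by rewrite to_radical_le leUx -!Order.le_val. Qed.

HB.instance Definition _ :=
  Order.POrder_MeetJoin_isLattice.Build d radical radical_meetP radical_joinP.

Definition radical_bot : radical := to_radical \bot.
Definition radical_top : radical := to_radical \top.

Fact radical_le0x x : radical_bot <= x.
Proof. by rewrite to_radical_le le0x. Qed.

Fact radical_lex1 x : x <= radical_top.
Proof. by rewrite -Order.le_val /= rho1 lex1. Qed.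

HB.instance Definition _ := Order.hasBottom.Build d radical radical_le0x.
HB.instance Definition _ := Order.hasTop.Build d radical radical_lex1.

Definition radical_qsup (S : set radical) : radical :=
  to_radical (qsup [set radical_val x | x in S]).

Fact radical_qsup_isLub (S : set radical) : isLub S (radical_qsup S).
Proof.
split=> [x Sx|b Sb].
  by rewrite -Order.le_val /= (le_trans _ (rho_ge _))// qsup_ub//; exists x.
rewrite to_radical_le; apply: qsup_le => _ [x Sx <-].
by rewrite (Order.le_val x b) Sb.
Qed.

Fact radical_meet1x : left_id (\top : radical) radical_meet.
Proof. exact: meet1x. Qed.

Fact radical_meet_qsup x (S : set radical) :
  radical_meet x (radical_qsup S) = radical_qsup [set radical_meet x y | y in S].
Proof.
apply/val_inj/le_anti/andP; split=> /=; last first.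
  rewrite lexI -{1}(radical_rho x) !rho_le radical_rho.
  apply/andP; split; apply: qsup_le => _ [_ [y Sy <-] <-] /=; first exact: leIl.
  apply: (le_trans (leIr _ _)); apply: (le_trans _ (rho_ge _)).
  by apply: qsup_ub; exists y.
rewrite -{1}(radical_rho x) -rhoM qmul_qsup le_rho//.
apply: qsup_le => _ [_ [y Sy <-] <-]; apply: (le_trans (qmul_leI _ _)).
by apply: qsup_ub; exists (radical_meet x y) => //; exists y.
Qed.

HB.instance Definition _ := TBLattice_isQuantale.Build d radical
  radical_qsup_isLub (@meetA d radical) (@meetC d radical)
  radical_meet1x radical_meet_qsup.

Lemma radical_is_frame : is_frame radical.
Proof. by []. Qed.

End Radical.

Section Compacts.
Context (d : Order.disp_t) (Q : quantaleType d).

Record compacts := Compacts { compacts_val : Q; compactsP : `[< compact_elt compacts_val >] }.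

HB.instance Definition _ := [isSub for compacts_val].
HB.instance Definition _ := [Choice of compacts by <:].

Lemma compacts_compact (c : compacts) : compact_elt (compacts_val c).
Proof. exact/asboolP/compactsP. Qed.

Definition to_compacts (c : Q) (cc : compact_elt c) : compacts :=
  Compacts (introT (asboolP _) cc).

Definition ret_equiv : rel compacts :=
  fun c e => rho (compacts_val c) == rho (compacts_val e).

Fact ret_equiv_refl : reflexive ret_equiv.
Proof. by move=> c; exact: eqxx. Qed.

Fact ret_equiv_sym : symmetric ret_equiv.
Proof. by move=> c e; exact: eq_sym. Qed.

Fact ret_equiv_trans : transitive ret_equiv.
Proof. by move=> c e f /eqP ec /eqP cf; apply/eqP; rewrite ec. Qed.

Canonical ret_equiv_rel :=
  EquivRel ret_equiv ret_equiv_refl ret_equiv_sym ret_equiv_trans.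

End Compacts.

Arguments compacts_compact {d Q} c.

Section Reticulation.
Context (d : Order.disp_t) (A : coherentQuantaleType d).

Definition reticulation : Type := {eq_quot (@ret_equiv d A)}.
HB.instance Definition _ := Choice.on reticulation.
HB.instance Definition _ := EqQuotient.on reticulation.

Implicit Types (c e : compacts A) (x y z : reticulation).

Definition compacts_join c e : compacts A :=
  to_compacts (compactU (compacts_compact c) (compacts_compact e)).

Definition compacts_mul c e : compacts A :=
  to_compacts (compact_qmul _ _ (compacts_compact c) (compacts_compact e)).

Definition ret_rho x : A := rho (compacts_val (repr x)).

Lemma ret_rho_pi c : ret_rho (\pi_reticulation c) = rho (compacts_val c).
Proof. by rewrite /ret_rho; apply/eqP; apply/(@eqmodP _ (ret_equiv_rel A)); rewrite reprK. Qed.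

Lemma ret_rho_inj : injective ret_rho.
Proof.
move=> x y xy; rewrite -(reprK x) -(reprK y).
by apply/(@eqmodP _ (ret_equiv_rel A)); apply/eqP.
Qed.

Definition ret_le x y : bool := ret_rho x <= ret_rho y.
Definition ret_join x y : reticulation := \pi_reticulation (compacts_join (repr x) (repr y)).
Definition ret_meet x y : reticulation := \pi_reticulation (compacts_mul (repr x) (repr y)).

Fact ret_le_refl : reflexive ret_le.
Proof. by move=> x; exact: lexx. Qed.

Fact ret_le_anti : antisymmetric ret_le.
Proof. by move=> x y xy; apply/ret_rho_inj/le_anti. Qed.

Fact ret_le_trans : transitive ret_le.
Proof. by move=> x y z; exact: le_trans. Qed.

HB.instance Definition _ := Order.Le_isPOrder.Build d reticulation
  ret_le_refl ret_le_anti ret_le_trans.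

Lemma ret_rho_le x y : (x <= y) = (ret_rho x <= ret_rho y).
Proof. by []. Qed.

Lemma ret_rho_join x y : ret_rho (ret_join x y) = rho (ret_rho x `|` ret_rho y).
Proof. by rewrite ret_rho_pi /= rhoU. Qed.

Lemma ret_rho_meet x y : ret_rho (ret_meet x y) = ret_rho x `&` ret_rho y.
Proof. by rewrite ret_rho_pi /= rhoM. Qed.

Fact ret_meetP x y z : (x <= ret_meet y z) = (x <= y) && (x <= z).
Proof. by rewrite !ret_rho_le ret_rho_meet lexI. Qed.

Fact ret_joinP x y z : (ret_join x y <= z) = (x <= z) && (y <= z).
Proof. by rewrite !ret_rho_le ret_rho_join rho_le leUx. Qed.

HB.instance Definition _ :=
  Order.POrder_MeetJoin_isLattice.Build d reticulation ret_meetP ret_joinP.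

Fact ret_meetUl : left_distributive ret_meet ret_join.
Proof.
move=> x y z; apply: ret_rho_inj; rewrite ret_rho_join !ret_rho_meet ret_rho_join.
by rewrite rhoU rhoUI !rhoM.
Qed.

HB.instance Definition _ :=
  Order.Lattice_Meet_isDistrLattice.Build d reticulation ret_meetUl.

Definition ret_bot : reticulation := \pi_reticulation (to_compacts (@compact_bot d A)).
Definition ret_top : reticulation := \pi_reticulation (to_compacts (@compact_top d A)).

Fact ret_le0x x : ret_bot <= x.
Proof. by rewrite ret_rho_le ret_rho_pi /= rho_le le0x. Qed.

Fact ret_lex1 x : x <= ret_top.
Proof. by rewrite ret_rho_le ret_rho_pi /= rho1 lex1. Qed.

HB.instance Definition _ := Order.hasBottom.Build d reticulation ret_le0x.
HB.instance Definition _ := Order.hasTop.Build d reticulation ret_lex1.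

Lemma ret_piU c e :
  \pi_reticulation (compacts_join c e) = \pi_reticulation c `|` \pi_reticulation e.
Proof. by apply: ret_rho_inj; rewrite ret_rho_join !ret_rho_pi rhoU. Qed.

Lemma ret_piM c e :
  \pi_reticulation (compacts_mul c e) = \pi_reticulation c `&` \pi_reticulation e.
Proof. by apply: ret_rho_inj; rewrite ret_rho_meet !ret_rho_pi rhoM. Qed.

End Reticulation.

Record lattice_ideal (d : Order.disp_t) (L : tbDistrLatticeType d) := LatticeIdeal {
  ideal_set : set L;
  ideal_bot : ideal_set \bot;
  ideal_join : forall x y, ideal_set x -> ideal_set y -> ideal_set (x `|` y);
  ideal_down : forall x y, x <= y -> ideal_set y -> ideal_set x
}.

Section IdealQuotient.
Context (d : Order.disp_t) (L : tbDistrLatticeType d) (I : lattice_ideal L).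

Definition ideal_equiv : rel L :=
  fun x y => `[< exists i, ideal_set I i /\ x `|` i = y `|` i >].

Fact ideal_equiv_refl : reflexive ideal_equiv.
Proof. by move=> x; apply/asboolP; exists \bot; split=> //; exact: ideal_bot. Qed.

Fact ideal_equiv_sym : symmetric ideal_equiv.
Proof. by move=> x y; apply/asboolP/asboolP => -[i [Ii xy]]; exists i. Qed.

Fact ideal_equiv_trans : transitive ideal_equiv.
Proof.
move=> y x z /asboolP[i [Ii xy]] /asboolP[j [Ij yz]]; apply/asboolP.
exists (i `|` j); split; first exact: ideal_join.
by rewrite joinA xy joinAC yz joinAC -joinA.
Qed.

Canonical ideal_equiv_rel :=
  EquivRel ideal_equiv ideal_equiv_refl ideal_equiv_sym ideal_equiv_trans.

Definition ideal_quot : Type := {eq_quot ideal_equiv}.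
HB.instance Definition _ := Choice.on ideal_quot.
HB.instance Definition _ := EqQuotient.on ideal_quot.

Implicit Types x y z : ideal_quot.

Definition iq_meet x y : ideal_quot := \pi_ideal_quot (repr x `&` repr y).
Definition iq_join x y : ideal_quot := \pi_ideal_quot (repr x `|` repr y).

Lemma iq_eqP (a b : L) :
  \pi_ideal_quot a = \pi_ideal_quot b <-> exists i, ideal_set I i /\ a `|` i = b `|` i.
Proof.
split=> [/(@eqmodP _ ideal_equiv_rel)/asboolP//|ab].
by apply/(@eqmodP _ ideal_equiv_rel)/asboolP.
Qed.

Lemma iq_repr (a : L) : exists i, ideal_set I i /\ repr (\pi_ideal_quot a) `|` i = a `|` i.
Proof. by apply/iq_eqP; rewrite reprK. Qed.

Lemma iq_piI (a b : L) :
  \pi_ideal_quot (a `&` b) = iq_meet (\pi_ideal_quot a) (\pi_ideal_quot b).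
Proof.
have [i [Ii ai]] := iq_repr a; have [j [Ij bj]] := iq_repr b.
apply/iq_eqP; exists (i `|` j); split; first exact: ideal_join.
by rewrite !joinIl !joinA ai -!(joinAC _ j) bj.
Qed.

Lemma iq_piU (a b : L) :
  \pi_ideal_quot (a `|` b) = iq_join (\pi_ideal_quot a) (\pi_ideal_quot b).
Proof.
have [i [Ii ai]] := iq_repr a; have [j [Ij bj]] := iq_repr b.
apply/iq_eqP; exists (i `|` j); split; first exact: ideal_join.
by rewrite joinACA -ai -bj -joinACA.
Qed.

Definition iq_le x y : bool := iq_meet x y == x.
Definition iq_lt x y : bool := (y != x) && iq_le x y.

Fact iq_le_def x y : iq_le x y = (iq_meet x y == x).
Proof. by []. Qed.

Fact iq_lt_def x y : iq_lt x y = (y != x) && iq_le x y.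
Proof. by []. Qed.

Fact iq_meetC : commutative iq_meet.
Proof. by move=> x y; rewrite /iq_meet meetC. Qed.

Fact iq_joinC : commutative iq_join.
Proof. by move=> x y; rewrite /iq_join joinC. Qed.

Fact iq_meetA : associative iq_meet.
Proof.
elim/quotW=> a; elim/quotW=> b; elim/quotW=> c.
by rewrite -(iq_piI b c) -(iq_piI a b) -iq_piI -iq_piI meetA.
Qed.

Fact iq_joinA : associative iq_join.
Proof.
elim/quotW=> a; elim/quotW=> b; elim/quotW=> c.
by rewrite -(iq_piU b c) -(iq_piU a b) -iq_piU -iq_piU joinA.
Qed.

Fact iq_joinKI y x : iq_meet x (iq_join x y) = x.
Proof.
by elim/quotW: x => a; elim/quotW: y => b; rewrite -(iq_piU a b) -iq_piI joinKI.
Qed.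

Fact iq_meetKU y x : iq_join x (iq_meet x y) = x.
Proof.
by elim/quotW: x => a; elim/quotW: y => b; rewrite -(iq_piI a b) -iq_piU meetKU.
Qed.

Fact iq_meetUl : left_distributive iq_meet iq_join.
Proof.
elim/quotW=> a; elim/quotW=> b; elim/quotW=> c.
by rewrite -(iq_piU a b) -(iq_piI a c) -(iq_piI b c) -iq_piI -iq_piU meetUl.
Qed.

Fact iq_meetxx : idempotent_op iq_meet.
Proof. by elim/quotW=> a; rewrite -iq_piI meetxx. Qed.

HB.instance Definition _ := Order.isMeetJoinDistrLattice.Build d ideal_quot
  iq_le_def iq_lt_def iq_meetC iq_joinC iq_meetA iq_joinA iq_joinKI iq_meetKU
  iq_meetUl iq_meetxx.

Fact iq_le0x x : \pi_ideal_quot \bot <= x.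
Proof. by elim/quotW: x => a; rewrite leEmeet; apply/eqP; rewrite -[LHS]iq_piI meet0x. Qed.

Fact iq_lex1 x : x <= \pi_ideal_quot \top.
Proof. by elim/quotW: x => a; rewrite leEmeet; apply/eqP; rewrite -[LHS]iq_piI meetx1. Qed.

HB.instance Definition _ := Order.hasBottom.Build d ideal_quot iq_le0x.
HB.instance Definition _ := Order.hasTop.Build d ideal_quot iq_lex1.

End IdealQuotient.

Section LiftingAndNormality.
Context (d : Order.disp_t).

Definition elt_has_LP (Q : quantaleType d) (a : Q) : Prop :=
  set_surj (complemented Q) (complemented (upset a)) (to_upset a).

Definition has_LP (Q : quantaleType d) : Prop := forall a : Q, elt_has_LP a.

Definition B_normal (Q : quantaleType d) : Prop :=
  forall a b : Q, a `|` b = \top ->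
    exists e f : Q, [/\ complemented Q e, complemented Q f,
      a `|` e = \top, b `|` f = \top & e *q f = \bot].

Definition lattice_B_normal (L : tbDistrLatticeType d) : Prop :=
  forall a b : L, a `|` b = \top ->
    exists e f : L, [/\ complemented L e, complemented L f,
      a `|` e = \top, b `|` f = \top & e `&` f = \bot].

Definition has_Id_BLP (L : tbDistrLatticeType d) : Prop :=
  forall I : lattice_ideal L,
    set_surj (complemented L) (complemented (ideal_quot I)) \pi_(ideal_quot I).

End LiftingAndNormality.

(* Main.v *)
Require Import Defs.
From mathcomp Require Import all_boot all_order.
From mathcomp Require Import boolp classical_sets cardinality.

Set Implicit Arguments.
Unset Strict Implicit.
Unset Printing Implicit Defensive.

(** B-normality says that whenever [a `|` b = \top] there is a complemented
    [g <= a] with [g `|` b = \top].  In this form it is equivalent to the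
    lifting property inside every single quantale or distributive lattice:
    lift the complemented element [a] of the quotient by [a `&` b], and
    conversely recover [x] as [g `|` (x `&` y)].  It then remains to move such
    [g] around [A -> R(A) -> L(A) -> A].  Complemented elements of [R(A)] are
    radicals of compact elements because the top is compact, and a
    complementary pair [g, h] of [L(A)] is lifted to [A] by a large common power
    [g^n, h^n]: a compact element below [rho a] has a power below [a]. *)

Import Order.LTheory.
Local Open Scope classical_set_scope.
Local Open Scope order_scope.
Local Open Scope quotient_scope.

(** * Comaximal elements and lifting in a single quantale *)

Section Quantales.
Context (d : Order.disp_t) (Q : quantaleType d).
Implicit Types (a b c e f g x y : Q) (S : set Q).

(** Multiply the meet by [\top], written as the join of [x] and [y]: both resulting terms lie below
    [x *q y]. *)
Lemma join_top_meetE x y : x `|` y = \top -> x `&` y = x *q y.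
Proof.
move=> xy1; apply/le_anti; rewrite qmul_leI andbT.
rewrite -{1}(qmulx1 (x `&` y)) -xy1 qmulUr leUx; apply/andP; split.
  by rewrite qmulC le_qmul ?leIr.
by rewrite le_qmul ?leIl.
Qed.

(** Expand the product of the two joins: every term except [a *q b] has [x] as a factor. *)
Lemma join_qmul_top a b x :
  a `|` x = \top -> b `|` x = \top -> (a *q b) `|` x = \top.
Proof.
move=> ax bx; apply/le_anti; rewrite lex1 /= -(qmulx1 \top) -{1}ax -bx.
rewrite qmulUr !qmulUl !leUx leUl /= !lexU2 ?qmul_lel ?qmul_ler ?orbT//.
Qed.

Lemma le_join_qmul a x y : a `|` y = \top -> x *q y <= a -> x <= a.
Proof.
by move=> ay xya; rewrite -(qmulx1 x) -ay qmulUr leUx qmul_ler.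
Qed.

Lemma B_normalP : B_normal Q <->
  forall a b, a `|` b = \top ->
    exists g, [/\ complemented Q g, g <= a & g `|` b = \top].
Proof.
split=> [BN a b /BN[e [f [[e' [ee0 ee1]] _ ae bf ef]]]|BN a b /BN].
  (* The witness is the complement of [e]: it is below [a] since [a] and [e] join to [\top], and
     above [f] since [e *q f = \bot]. *)
  exists e'; split; first by exists e; rewrite meetC joinC.
    rewrite (le_join_qmul (y := e))// qmulC -join_top_meetE// ee0.
    exact: le0x.
  apply/le_anti; rewrite lex1 /= -bf leUx leUr /= lexU2//.
  apply/orP; left; rewrite (le_join_qmul (y := e)) 1?joinC//.
  by rewrite qmulC ef le0x.
move=> [g [[h [gh0 gh1]] ga gb1]]; exists h, g; split.
- by exists g; rewrite meetC joinC.
- by exists h.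
- by apply/le_anti; rewrite lex1 -gh1 leU2.
- by rewrite joinC.
- by rewrite qmulC -join_top_meetE.
Qed.

Lemma has_LP_B_normal : has_LP Q <-> B_normal Q.
Proof.
split=> [LP|/B_normalP BN a].
  apply/B_normalP => a b ab1.
  have ge_a : a `&` b <= a by exact: leIl.
  have ge_b : a `&` b <= b by exact: leIr.
  have : complemented (upset (a `&` b)) (Upset ge_a).
    by exists (Upset ge_b); split; apply: val_inj.
  move=> /LP[g Bg /(congr1 val)/= ga]; exists g; split=> //.
    by rewrite -ga leUl.
  apply/le_anti; rewrite lex1 /= -ab1 leUx leUr andbT -ga leUx leUl /=.
  by rewrite lexU2// leIr orbT.
move=> [x ax] [[y ay] [/(congr1 val)/= xy0 /(congr1 val)/= xy1]].
have [g [Bg gx gy]] := BN _ _ xy1; exists g => //; apply/val_inj/le_anti => /=.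
(* Multiplying [x] by the join of [g] and [y] splits it into a term below [g] and one below the meet
   of [x] and [y], which is [a]. *)
rewrite leUx gx ax /= -{1}(qmulx1 x) -gy qmulUr leUx lexU2 ?qmul_ler//=.
by rewrite lexU2// -xy0 qmul_leI orbT.
Qed.

(** * Powers, m-prime elements and the radical *)

Definition qexp x n : Q := iter n (qmul x) \top.

Lemma qexpD x m n : qexp x (m + n) = qexp x m *q qexp x n.
Proof. by elim: m => [|m IH]; rewrite ?qmul1x// addSn /= IH qmulA. Qed.

Lemma qexpMn x y n : qexp (x *q y) n = qexp x n *q qexp y n.
Proof.
elim: n => [|n IH]; rewrite ?qmul1x//= IH -!qmulA; congr (_ *q _).
by rewrite !qmulA (qmulC y).
Qed.

Lemma qexp_le x m n : (m <= n)%N -> qexp x n <= qexp x m.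
Proof. by move=> /subnKC <-; rewrite qexpD qmul_lel. Qed.

Lemma qexp_join_top x y n : x `|` y = \top -> qexp x n `|` y = \top.
Proof.
move=> xy; elim: n => [|n IH]; first by rewrite /= join1x.
exact: join_qmul_top.
Qed.

Lemma directed_finite_ub S (F : set Q) :
  S !=set0 -> (forall x y, S x -> S y -> exists2 z, S z & x `|` y <= z) ->
  finite_set F -> F `<=` S -> exists2 s, S s & qsup F <= s.
Proof.
move=> [s0 Ss0] dirS /finite_seqP[r ->] {F}.
elim: r => [|x r IH] rS; first by exists s0 => //; apply: qsup_le.
have [|s Ss rs] := IH; first by move=> y yr; apply: rS; rewrite /= inE (yr : y \in r) orbT.
have Sx : S x by apply: rS; rewrite /= inE eqxx.
have [z Sz xsz] := dirS _ _ Sx Ss; exists z => //.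
apply: qsup_le => y /=; rewrite inE => /orP[/eqP ->|yr].
  exact: le_trans (leUl _ _) xsz.
apply: (le_trans _ (le_trans (leUr _ _) xsz)); apply: (le_trans _ rs).
exact: qsup_ub.
Qed.

Lemma compact_directed c S : compact_elt c -> S !=set0 ->
  (forall x y, S x -> S y -> exists2 z, S z & x `|` y <= z) ->
  c <= qsup S -> exists2 s, S s & c <= s.
Proof.
move=> cc S0 dirS /cc[F [finF FS cF]].
have [s Ss Fs] := directed_finite_ub S0 dirS finF FS.
by exists s => //; exact: le_trans Fs.
Qed.

(* Krull's argument: an element maximal among those above [a] and above no
   power of [c] is m-prime. *)
Lemma mprime_avoid a c :
  (forall n, compact_elt (qexp c n)) -> (forall n, ~ qexp c n <= a) ->
  exists p, [/\ mprime p, a <= p & ~ c <= p].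
Proof.
move=> cc ca.
pose T := {x : Q | a <= x /\ forall n, ~ qexp c n <= x}.
pose t0 : T := exist _ a (conj (lexx a) ca).
have [||C totC|[p [ap cp]] pmax] :=
    @ZL_preorder T t0 (fun u v => sval u <= sval v).
- by move=> t; exact: lexx.
- by move=> r s t; exact: le_trans.
- have [[t Ct]|C0] := pselect (C !=set0); last first.
    by exists t0 => s Cs; case: C0; exists s.
  pose S := [set sval x | x in C].
  have aS : a <= qsup S.
    by apply: (le_trans (svalP t).1); apply: qsup_ub; exists t.
  (* A power of [c] below the supremum of the chain is compact, hence already below one member. *)
  have cS n : ~ qexp c n <= qsup S.
    move=> /(compact_directed (cc n)) [||_ [s Cs <-]].
    + by exists (sval t), t.
    + move=> _ _ [x Cx <-] [y Cy <-]; have [xy|yx] := totC _ _ Cx Cy.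
        by exists (sval y); [exists y|rewrite leUx xy lexx].
      by exists (sval x); [exists x|rewrite leUx yx lexx].
    exact: (svalP s).2.
  exists (exist _ (qsup S) (conj aS cS)) => s Cs /=.
  by apply: qsup_ub; exists s.
(* By maximality, joining to [p] anything not below it leaves the Zorn family. *)
have above x : ~ x <= p -> exists n, qexp c n <= p `|` x.
  move=> xp; apply: contrapT => /forallNP nx.
  have apx : a <= p `|` x by rewrite lexU2 ?ap.
  have := pmax (exist _ (p `|` x) (conj apx nx)); rewrite /= leUl leUx lexx /=.
  by move=> /(_ isT).
exists p; split=> //; last by move=> cp1; apply: (cp 1); rewrite /= qmulx1.
split=> [|x y xyp].
  by rewrite lt_neqAle lex1 andbT; apply/eqP => p1; apply: (cp 0); rewrite p1 lex1.
apply: contrapT => /not_orP[/above[n nx] /above[m my]].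
(* In the product of the joins of [p] with [x] and with [y], every term is below [p]. *)
apply: (cp (n + m)%N); rewrite qexpD; apply: (le_trans (le_qmul nx my)).
by rewrite qmulUl leUx qmul_lel qmulUr leUx qmul_ler xyp.
Qed.

(** Otherwise an m-prime above [a] but not above [c] would still be above [rho a]. *)
Lemma compact_le_rho a c : (forall n, compact_elt (qexp c n)) ->
  c <= rho a -> exists n, qexp c n <= a.
Proof.
move=> cc ca; apply: contrapT => /forallNP /(mprime_avoid cc)[p [pp ap]]; apply.
exact: (le_trans ca (rho_le_mprime pp ap)).
Qed.

End Quantales.

(** * Lifting modulo ideals in a distributive lattice *)

Section DistributiveLattices.
Context (d : Order.disp_t) (L : tbDistrLatticeType d).
Implicit Types (a b e f g i x y : L).

Lemma lattice_B_normalP : lattice_B_normal L <->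
  forall a b, a `|` b = \top ->
    exists g, [/\ complemented L g, g <= a & g `|` b = \top].
Proof.
split=> [BN a b /BN[e [f [[e' [ee0 ee1]] _ ae bf ef]]]|BN a b /BN].
  have below x y : x `|` e = \top -> y `&` e = \bot -> y <= x.
    by move=> xe ye; rewrite -(meetx1 y) -xe meetUr ye joinx0 leIr.
  exists e'; split; first by exists e; rewrite meetC joinC.
    by rewrite below// meetC.
  apply/le_anti; rewrite lex1 /= -bf leUx leUr /= lexU2//.
  by rewrite below// 1?joinC// meetC.
move=> [g [[h [gh0 gh1]] ga gb1]]; exists h, g; split.
- by exists g; rewrite meetC joinC.
- by exists h.
- by apply/le_anti; rewrite lex1 -gh1 leU2.
- by rewrite joinC.
- by rewrite meetC.
Qed.

(** Kept transparent so that membership computes to [x <= a]. *)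
Definition principal_ideal a : lattice_ideal L.
Proof.
apply: (@LatticeIdeal d L [set x | x <= a]) => /=; first exact: le0x.
  by move=> x y xa ya; rewrite leUx xa.
by move=> x y; exact: le_trans.
Defined.

Lemma has_Id_BLP_B_normal : has_Id_BLP L <-> lattice_B_normal L.
Proof.
split=> [BLP|/lattice_B_normalP BN I].
  apply/lattice_B_normalP => a b ab1; pose I := principal_ideal (a `&` b).
  have : complemented (ideal_quot I) (\pi_(ideal_quot I) a).
    exists (\pi_(ideal_quot I) b); split.
      rewrite -[LHS]iq_piI; apply/iq_eqP; exists (a `&` b).
      by split; [exact: lexx|rewrite joinxx join0x].
    by rewrite -[LHS]iq_piU ab1.
  move=> /BLP[g Bg /iq_eqP[i [iab gi]]].
  have /andP[ia ib] : (i <= a) && (i <= b) by rewrite -lexI.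
  have gia : g `|` i = a by rewrite gi; exact/join_idPl.
  exists g; split=> //; first by rewrite -gia leUl.
  by apply/le_anti; rewrite lex1 /= -ab1 -gia !leUx leUl leUr (lexU2 (y := g))// ib orbT.
elim/quotW=> x [+ []]; elim/quotW=> y.
rewrite -[_ `&` _]iq_piI -[_ `|` _]iq_piU.
move=> /iq_eqP[i [Ii xyi]] /iq_eqP[j [Ij xyj]].
(* The classes of [x] and [y] join to the top only modulo [j]; absorbing [j] into [x] gives an
   honest cover in [L]. *)
have xy1 : (x `|` j) `|` y = \top by rewrite joinAC xyj join1x.
have [g [Bg gx gy]] := BN _ _ xy1; exists g => //; apply/iq_eqP.
exists (i `|` j); split; first exact: ideal_join.
apply/le_anti/andP; split; rewrite leUx leUr andbT.
  by apply: (le_trans gx); rewrite leU2 ?leUr.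
apply: (@le_trans _ _ (x `&` (g `|` y))); first by rewrite gy meetx1.
rewrite meetUr leUx (le_trans (leIr _ _)) ?leUl//=.
apply: (@le_trans _ _ i); last by rewrite joinCA leUl.
by move: xyi; rewrite join0x => <-; exact: leUl.
Qed.

End DistributiveLattices.

(** * Transfer between a coherent quantale, its radical frame and its reticulation *)

Section Coherent.
Context (d : Order.disp_t) (A : coherentQuantaleType d).
Implicit Types (a b c x y : A).

Lemma compact_qexp c n : compact_elt c -> compact_elt (qexp c n).
Proof.
by move=> cc; elim: n => [|n IH]; [exact: compact_top|exact: compact_qmul].
Qed.

(** Every power of [\top] is [\top], and it is compact. This lets covers of the top descend from
    radicals to [A]. *)
Lemma rho_eq_top a : rho a = \top -> a = \top.
Proof.
move=> a1; have [||n na] := @compact_le_rho _ A a \top.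
- by move=> n; apply: compact_qexp; exact: compact_top.
- by rewrite a1.
apply/le_anti; rewrite lex1; apply: le_trans na.
by elim: n => //= n IH; rewrite qmul1x.
Qed.

(** The joins of a compact below [a] with a compact below [b] form a directed family with supremum
    [\top]; compactness of [\top] selects one. *)
Lemma join_top_compact a b : a `|` b = \top -> exists c e : A,
  [/\ compact_elt c, compact_elt e, c <= a, e <= b & c `|` e = \top].
Proof.
move=> ab1.
pose S := [set z | exists c e : A,
  [/\ compact_elt c, compact_elt e, c <= a, e <= b & c `|` e = z]].
have [|||_ [c [e [cc ce ca eb <-]]] ce1] := @compact_directed _ A \top S compact_top.
- by exists (\bot `|` \bot), \bot, \bot; split=> //; exact: compact_bot || exact: le0x.
- move=> _ _ [c [e [cc ce ca eb <-]]] [c' [e' [cc' ce' ca' eb' <-]]].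
  exists ((c `|` e) `|` (c' `|` e')) => //; exists (c `|` c'), (e `|` e').
  by rewrite !leUx ca ca' eb eb' joinACA; split=> //; exact: compactU.
- rewrite -ab1; have [Sa [cSa aE]] := compact_gen a; have [Sb [cSb bE]] := compact_gen b.
  rewrite leUx {1}aE {1}bE; apply/andP; split; apply: qsup_le => c Sc; apply: qsup_ub.
    exists c, \bot; rewrite joinx0 le0x; split=> //; [exact: cSa|exact: compact_bot|].
    by rewrite aE qsup_ub.
  exists \bot, c; rewrite join0x le0x; split=> //; [exact: compact_bot|exact: cSb|].
  by rewrite bE qsup_ub.
by exists c, e; split=> //; apply/le_anti; rewrite lex1.
Qed.

Lemma radical_join_top (x y : radical A) :
  x `|` y = \top <-> radical_val x `|` radical_val y = \top.
Proof.
split=> [/(congr1 val) /= xy|xy]; first by apply: rho_eq_top; rewrite xy rho1.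
by apply: val_inj; rewrite /= xy.
Qed.

Lemma B_normal_radical : B_normal A -> B_normal (radical A).
Proof.
move=> /B_normalP BN; apply/B_normalP => x y /radical_join_top /BN.
move=> [g [[h [gh0 gh1]] gx gy]]; exists (to_radical g); split.
- exists (to_radical h); split.
    by apply: val_inj; rewrite /= -rhoI gh0.
  by apply: val_inj; rewrite /= rhoU gh1.
- by rewrite to_radical_le.
- apply/radical_join_top/le_anti; rewrite lex1 /= -gy leU2 ?rho_ge//.
Qed.

Lemma complemented_radical (g h : radical A) :
  g `&` h = \bot -> g `|` h = \top ->
  exists2 c : A, compact_elt c & radical_val g = rho c.
Proof.
move=> /(congr1 val) /= gh0 /radical_join_top gh1.
have [c [e [cc _ cg eh ce1]]] := join_top_compact gh1.
exists c => //; apply/le_anti/andP; split; last first.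
  by rewrite -(radical_rho g) le_rho.
(* As [e] is below [h], the product of [g] and [e] is below their common bottom [rho \bot]. *)
apply: (@le_join_qmul _ _ _ _ e).
  by apply/le_anti; rewrite lex1 /= -ce1 leU2// rho_ge.
apply: (le_trans (qmul_leI _ _)); apply: (@le_trans _ _ (rho \bot)).
  by rewrite -gh0 leI2.
by rewrite le_rho// le0x.
Qed.

Lemma ret_join_top (c e : compacts A) :
  \pi_(reticulation A) c `|` \pi_(reticulation A) e = \top <->
  compacts_val c `|` compacts_val e = \top.
Proof.
rewrite -ret_piU; split=> [/(congr1 (@ret_rho _ _))|ce1].
  by rewrite !ret_rho_pi /= rho1 => /rho_eq_top.
by apply: ret_rho_inj; rewrite !ret_rho_pi /= ce1.
Qed.

(** The bottom class consists of the compacts below [rho \bot], so the product need not be [\bot]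
    itself. *)
Lemma ret_meet_bot (c e : compacts A) :
  \pi_(reticulation A) c `&` \pi_(reticulation A) e = \bot <->
  compacts_val c *q compacts_val e <= rho \bot.
Proof.
rewrite -ret_piM; split=> [/(congr1 (@ret_rho _ _))|ce0].
  by rewrite !ret_rho_pi /= => <-; exact: rho_ge.
apply: ret_rho_inj; rewrite !ret_rho_pi /=; apply/le_anti.
by rewrite rho_le ce0 le_rho// le0x.
Qed.

Lemma ret_le_pi (c e : compacts A) :
  (\pi_(reticulation A) c <= \pi_(reticulation A) e) =
  (compacts_val c <= rho (compacts_val e)).
Proof. by rewrite ret_rho_le !ret_rho_pi rho_le. Qed.

Lemma radical_B_normal_reticulation :
  B_normal (radical A) -> lattice_B_normal (reticulation A).
Proof.
move=> /B_normalP BN; apply/lattice_B_normalP.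
elim/quotW=> c; elim/quotW=> e /ret_join_top ce1.
have /BN[g [[h [gh0 gh1]] gc ge]] :
    to_radical (compacts_val c) `|` to_radical (compacts_val e) = \top.
  by apply: val_inj; rewrite /= rhoU ce1.
have [u cu gu] := complemented_radical gh0 gh1.
have [v cv hv] : exists2 v : A, compact_elt v & radical_val h = rho v.
  by apply: (@complemented_radical h g); rewrite 1?meetC 1?joinC.
exists (\pi_(reticulation A) (to_compacts cu)); split.
- exists (\pi_(reticulation A) (to_compacts cv)); split.
    apply/ret_meet_bot => /=; move/(congr1 val): gh0 => /= <-.
    by rewrite gu hv -rhoM rho_ge.
  apply/ret_join_top => /=; apply: rho_eq_top; rewrite -rhoU -gu -hv.
  by move/radical_join_top: gh1 => ->; exact: rho1.
- rewrite ret_le_pi /=; apply: (le_trans (rho_ge u)); rewrite -gu.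
  exact: gc.
- apply/ret_join_top => /=; apply: rho_eq_top; rewrite -rhoU -gu.
  by move/radical_join_top: ge => /= ->; exact: rho1.
Qed.

Lemma reticulation_B_normal : lattice_B_normal (reticulation A) -> B_normal A.
Proof.
move=> /lattice_B_normalP BN; apply/B_normalP => x y.
move=> /join_top_compact[c [e [cc ce cx ey ce1]]].
have /BN : \pi_(reticulation A) (to_compacts cc)
    `|` \pi_(reticulation A) (to_compacts ce) = \top by apply/ret_join_top.
move=> [+ [[]]]; elim/quotW=> g; elim/quotW=> h.
move=> [/ret_meet_bot gh0 /ret_join_top gh1].
rewrite ret_le_pi /= => gc /ret_join_top /= ge1.
have cg := compacts_compact g; have ch := compacts_compact h.
have [k kc] := compact_le_rho (fun n => @compact_qexp _ n cg) gc.
have [m ghm] := compact_le_rho (fun n => @compact_qexp _ n (compact_qmul _ _ cg ch)) gh0.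
(* Exponent [k] brings the power of [g] below [c]; exponent [m] kills the product of [g] and [h]. *)
pose n := maxn k m.
have ghn1 : qexp (compacts_val g) n `|` qexp (compacts_val h) n = \top.
  by apply: qexp_join_top; rewrite joinC; apply: qexp_join_top; rewrite joinC.
exists (qexp (compacts_val g) n); split.
(* The two powers are comaximal, so their meet is their product, the [n]-th power of the product of
   [g] and [h]. *)
- exists (qexp (compacts_val h) n); split=> //; rewrite join_top_meetE// -qexpMn.
  apply/le_anti; rewrite le0x andbT; apply: le_trans ghm.
  by apply: qexp_le; rewrite leq_maxr.
- by apply: le_trans cx; apply: le_trans kc; apply: qexp_le; rewrite leq_maxl.
- apply/le_anti; rewrite lex1 /= -(qexp_join_top n ge1) leU2//.
Qed.

End Coherent.

Theorem theorem6p6 (d : Order.disp_t) (A : coherentQuantaleType d) :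
  [<-> has_LP A;
       has_LP (radical A);
       has_Id_BLP (reticulation A);
       B_normal A;
       B_normal (radical A);
       lattice_B_normal (reticulation A)].
Proof.
(* The transfers from [A] to [radical A] to [reticulation A] and back are run twice, first for
   lifting, then for B-normality. *)
tfae.
- by move=> /has_LP_B_normal /B_normal_radical /has_LP_B_normal.
- move=> /has_LP_B_normal /radical_B_normal_reticulation.
  by move=> /has_Id_BLP_B_normal.
- by move=> /has_Id_BLP_B_normal /reticulation_B_normal.
- exact: B_normal_radical.
- exact: radical_B_normal_reticulation.
- by move=> /reticulation_B_normal /has_LP_B_normal.
Qed.
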